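(* Let $\mathbb{F}$ be a field with at least three elements and $m,n$ integers with $m\ge n\ge 2$. Assume that $\phi : M_{m,n}\to M_{m,n}$ is a bijective map such that for every pair $A,B\in M_{m,n}$ the matrix $A-B$ is of full rank if and only if $\phi(A)-\phi(B)$ is of full rank. Then one of the following holds. (i) There exist an invertible $m\times m$ matrix $T$, an invertible $n\times n$ matrix $S$, an $m\times n$ matrix $R$ (all over $\mathbb{F}$), and a field automorphism $\sigma:\mathbb{F}\to\mathbb{F}$ such that $$\phi(A)=TA_\sigma S+R\quad\text{for every } A\in M_{m,n}.$$ (ii) $m=n$, and there exist $T,S,R\in M_{n,n}$ with $T$ and $S$ invertible and a field automorphism $\sigma$ of $\mathbb{F}$ such that $$\phi(A)=TA_\sigma^{t}S+R\quad\text{for every } A\in M_{n,n}.$$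
   Context: $M_{m,n}$ denotes the linear space of all $m\times n$ matrices over the field $\mathbb{F}$. With $m\ge n$, a matrix $A\in M_{m,n}$ is of full rank if $\operatorname{rank}A=n$. For an automorphism $\sigma$ of $\mathbb{F}$ and $A=[a_{ij}]\in M_{m,n}$, $A_\sigma=[\sigma(a_{ij})]$ is the matrix obtained by applying $\sigma$ entrywise. $A^t$ denotes the transpose of $A$, and $A_\sigma^t=(A_\sigma)^t$. The map $\phi$ is not assumed to be linear or additive. *)

(* Defs.v *)
From mathcomp Require Import all_boot all_algebra.

Set Implicit Arguments.
Unset Strict Implicit.
Unset Printing Implicit Defensive.

(* Main.v *)
(** Three distinct matrices A, B, R satisfy "every X with R - X of full rank has
    A - X or B - X of full rank" exactly when A - B has rank one and R lies on
    the line through A and B. Hence phi and its inverse map lines in rank-one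
    directions onto such lines. For fixed X and x, the map sending w to
    phi (X + x w) - phi X therefore sends lines onto lines, and the fundamental
    theorem of affine geometry makes it semilinear; the same holds in x. So the
    increment of phi at X is a bisemilinear map of (x, w) with values of rank one,
    and it has the form f(x) g(w) or the transpose of this form. The increments
    at X and at X + x w agree on all (x, w') and all (x', w), which for maps of
    these forms implies equality. The increment thus does not depend on X, and
    phi is determined by its increment at 0. *)
From Stdlib Require Import Classical.
Require Import Defs.
From HB Require Import structures.
From mathcomp Require Import all_boot all_algebra.

Set Implicit Arguments.
Unset Strict Implicit.
Unset Printing Implicit Defensive.

Import GRing.Theory.
Local Open Scope ring_scope.

(** * Linear independence of two vectors *)

Definition indep (F : fieldType) (V : lmodType F) (u v : V) : Prop :=
  forall a b : F, a *: u + b *: v = 0 -> a = 0 /\ b = 0.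

Section Independence.

Variables (F : fieldType) (V : lmodType F).
Implicit Types (a b : F) (u v : V).

Lemma scaler_vecI v a b : v != 0 -> a *: v = b *: v -> a = b.
Proof.
move=> v0 /eqP; rewrite -subr_eq0 -scalerBl scaler_eq0 (negPf v0) orbF subr_eq0.
by move/eqP.
Qed.

Lemma indep_sym u v : indep u v -> indep v u.
Proof. by move=> uv a b; rewrite addrC => /uv[-> ->]. Qed.

Lemma indep_neq0 u v : indep u v -> u != 0.
Proof.
move=> uv; apply/eqP=> u0; have [] := uv 1 0.
  by rewrite u0 scaler0 scale0r addr0.
by move/eqP; rewrite oner_eq0.
Qed.

Lemma indepF u v a : indep u v -> v = a *: u -> False.
Proof.
move=> uv vE; have [] := uv a (-1).
  by rewrite vE scaleN1r subrr.
by move=> _ /eqP; rewrite oppr_eq0 oner_eq0.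
Qed.

Lemma indepP u v : u != 0 -> ~ (exists c, v = c *: u) -> indep u v.
Proof.
move=> u0 nuv a b E; have [b0|b0] := eqVneq b 0.
  move: E; rewrite b0 scale0r addr0 => /eqP; rewrite scaler_eq0 (negPf u0) orbF.
  by move/eqP.
case: nuv; exists (- (b^-1 * a)); apply: (scalerI b0).
by rewrite scalerA mulrN mulVKf // scaleNr; apply/eqP; rewrite -addr_eq0 addrC E.
Qed.

Lemma dep_or_indep u v : u != 0 -> (exists c, v = c *: u) \/ indep u v.
Proof.
by move=> u0; case: (classic (exists c, v = c *: u)); [left|right; apply: indepP].
Qed.

Lemma indep_add u v a : indep u v -> indep u (v + a *: u).
Proof.
move=> uv b c; rewrite scalerDr scalerA addrCA -scalerDl addrC => /uv[E c0].
by move: E; rewrite c0 mul0r addr0.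
Qed.

Lemma indep_scale u v a : a != 0 -> indep u v -> indep (a *: u) v.
Proof.
move=> a0 uv b c; rewrite scalerA => /uv[/eqP]; rewrite mulf_eq0 (negPf a0) orbF.
by move/eqP.
Qed.

End Independence.

Lemma exists_rmorphism (F : fieldType) (s : F -> F) :
  s 1 = 1 -> {morph s : a b / a + b} -> {morph s : a b / a * b} ->
  exists sigma : {rmorphism F -> F}, sigma =1 s.
Proof.
move=> s1 sD sM.
have s0 : s 0 = 0 by apply: (addrI (s 0)); rewrite -sD !addr0.
have sB : zmod_morphism s.
  move=> a b; apply: (addIr (s b)); by rewrite -sD !subrK.
pose sA := GRing.isZmodMorphism.Build F F s sB.
pose sMM := GRing.isMonoidMorphism.Build F F s (conj s1 sM).
pose sigma : {rmorphism F -> F} := HB.pack s sA sMM.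
by exists sigma.
Qed.

(** * Semilinear maps and the fundamental theorem of affine geometry *)

Definition semilinear_map (F : fieldType) (V W : lmodType F) (sigma : F -> F)
    (l : V -> W) : Prop :=
  {morph l : x y / x + y} /\ forall a x, l (a *: x) = sigma a *: l x.

Section FundamentalTheoremOfAffineGeometry.

Variables (F : fieldType) (V W : lmodType F) (l : V -> W).
Hypothesis F3 : forall a b : F, exists c : F, c != a /\ c != b.
Hypothesis l0 : l 0 = 0.
Hypothesis l_inj : injective l.
Hypothesis l_line :
  forall x y a, exists b, l (x + a *: (y - x)) = l x + b *: (l y - l x).
Hypothesis l_line_onto :
  forall x y b, exists a, l (x + a *: (y - x)) = l x + b *: (l y - l x).

Let l_scale x a : exists b, l (a *: x) = b *: l x.
Proof.
by have [b] := l_line 0 x a; rewrite l0 !subr0 !add0r => E; exists b.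
Qed.

Let l_scale_onto x b : exists a, l (a *: x) = b *: l x.
Proof.
by have [a] := l_line_onto 0 x b; rewrite l0 !subr0 !add0r => E; exists a.
Qed.

Let l_neq0 x : x != 0 -> l x != 0.
Proof. by apply: contraNneq => E; apply/eqP/l_inj; rewrite E l0. Qed.

(** Every multiple of [l x] is already the image of a multiple of [x], so by injectivity [l y]
    cannot be one. *)
Let l_indep x y : indep x y -> indep (l x) (l y).
Proof.
move=> xy; apply: indepP; first by apply: l_neq0; apply: indep_neq0 xy.
case=> c E; have [a E'] := l_scale_onto x c.
by apply: (indepF xy (a := a)); apply: l_inj; rewrite E E'.
Qed.

(* A point off the two axes of a plane lies on a line that meets both axes;
   this needs a third scalar. *)
Let l_plane x y a b : exists c d, l (a *: x + b *: y) = c *: l x + d *: l y.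
Proof.
have [->|a0] := eqVneq a 0.
  by have [d E] := l_scale y b; exists 0, d; rewrite !scale0r !add0r.
have [->|b0] := eqVneq b 0.
  by have [c E] := l_scale x a; exists c, 0; rewrite !scale0r !addr0.
have [al [al0 ala]] := F3 0 a.
(* Chosen so that [(1 - t) * al = a]: the given point has parameter [t] on the line from [al *: x]
   to [(b / t) *: y]. *)
pose t := 1 - a / al.
have t0 : t != 0.
  by rewrite subr_eq0 eq_sym; apply: contra ala => /eqP E; rewrite -(divfK al0 a) E mul1r.
have -> : a *: x + b *: y = al *: x + t *: ((b / t) *: y - al *: x).
  have Ea : al - t * al = a by rewrite mulrBl mul1r divfK // opprB addrC subrK.
  by rewrite scalerBr !scalerA [t * (_ / _)]mulrC divfK // addrCA -scalerBl Ea addrC.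
have [s ->] := l_line (al *: x) ((b / t) *: y) t.
have [c ->] := l_scale x al; have [d ->] := l_scale y (b / t).
exists (c - s * c), (s * d).
by rewrite scalerBr !scalerA scalerBl addrCA addrC.
Qed.

(* Parallel lines of a plane are disjoint, hence so are their images. *)
Let l_parallel x y : indep x y -> exists b, l (x + y) = l x + b *: l y.
Proof.
move=> xy; have [a [b E]] := l_plane x y 1 1; rewrite !scale1r in E.
exists b; rewrite E; have [->|a1] := eqVneq a 1; first by rewrite scale1r.
have a1' : 1 - a != 0 by rewrite subr_eq0 eq_sym.
(* At this parameter the line through [l x] and [l (x + y)] meets the line spanned by [l y]. *)
have [t] := l_line_onto x (x + y) (1 - a)^-1.
rewrite addrAC subrr add0r E.
have -> : l x + (1 - a)^-1 *: (a *: l x + b *: l y - l x)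
         = ((1 - a)^-1 * b) *: l y.
  rewrite addrAC scalerDr -{3}[l x]scale1r -scalerBl !scalerA addrA.
  rewrite -{1}[l x]scale1r -scalerDl -[a - 1]opprB mulrN mulVf // subrr.
  by rewrite scale0r add0r.
have [t' <-] := l_scale_onto y ((1 - a)^-1 * b).
move/l_inj => E'; have [] := xy 1 (t - t').
  by rewrite scale1r scalerBl addrA E' subrr.
by move/eqP; rewrite oner_eq0.
Qed.

(** [l_parallel] applied to [x, y] and to [y, x] gives two expansions of [l (x + y)]; comparing
    their coordinates makes both coefficients 1. *)
Let l_addI x y : indep x y -> l (x + y) = l x + l y.
Proof.
move=> xy; have [b E] := l_parallel xy.
have [a] := l_parallel (indep_sym xy); rewrite addrC E => E'.
have [] := l_indep xy (a := 1 - a) (b := b - 1).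
  rewrite !scalerBl !scale1r addrACA E' -opprD [a *: _ + _]addrC; exact: subrr.
by move=> _ /eqP; rewrite subr_eq0 => /eqP->; rewrite scale1r.
Qed.

Variables e1 e2 : V.
Hypothesis e12 : indep (V := V) e1 e2.

Let exists_indep (x : V) : x != 0 -> exists y, indep x y.
Proof.
move=> x0; case: (dep_or_indep e1 x0) => [[c E]|]; last by exists e1.
exists e2; have c0 : c != 0.
  by apply: contraTneq (indep_neq0 e12) => c0; rewrite E c0 scale0r eqxx.
have -> : x = c^-1 *: e1 by rewrite E scalerA mulVf // scale1r.
by apply: indep_scale; rewrite ?invr_eq0.
Qed.

(** For [y = c *: x], take [z] independent of [x] and expand [l (x + c *: x + z)] in two ways, using
    additivity on independent pairs only. *)
Let l_add : {morph l : x y / x + y}.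
Proof.
move=> x y; have [->|x0] := eqVneq x 0; first by rewrite l0 !add0r.
case: (dep_or_indep y x0) => [[c ->]|]; last exact: l_addI.
have [z xz] := exists_indep x0.
have zc a : l (a *: x + z) = l (a *: x) + l z.
  have [->|a0] := eqVneq a 0; first by rewrite scale0r l0 !add0r.
  by apply: l_addI; apply: indep_scale.
apply: (addIr (l z)); rewrite -[x + _ as X in l X](_ : (1 + c) *: x = _).
  rewrite -zc scalerDl scale1r -!addrA -zc l_addI //.
  by rewrite addrC; apply: indep_add.
by rewrite scalerDl scale1r.
Qed.

(** The factors at [x] and at [y] both equal the factor at [x + y], by additivity and the
    independence of [l x] and [l y]. *)
Let l_scale_eq x y a b :
  indep x y -> l (a *: x) = b *: l x -> l (a *: y) = b *: l y.
Proof.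
move=> xy E; have [c Ec] := l_scale y a; have [d] := l_scale (x + y) a.
rewrite scalerDr !l_add scalerDr E Ec => /eqP; rewrite -subr_eq0 opprD addrACA.
rewrite -!scalerBl => /eqP/(l_indep xy)[/eqP]; rewrite subr_eq0 => /eqP-> /eqP.
by rewrite subr_eq0 => /eqP->.
Qed.

Lemma affine_fundamental_theorem :
  exists2 sigma : {rmorphism F -> F},
    forall b, exists a, sigma a = b & semilinear_map sigma l.
Proof.
(* The boolean equality lets [xchoose] define the candidate automorphism [s] by its action on the
   line of [e1]. *)
have sP a : exists b, l (a *: e1) == b *: l e1.
  by have [b ->] := l_scale e1 a; exists b.
pose s a := xchoose (sP a).
have e1_0 : l e1 != 0 by apply: l_neq0; apply: indep_neq0 e12.
have sE a x : l (a *: x) = s a *: l x.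
  have E1 : l (a *: e1) = s a *: l e1 := eqP (xchooseP (sP a)).
  case: (dep_or_indep x (indep_neq0 e12)) => [[c ->]|e1x]; last exact: l_scale_eq E1.
  have [->|c0] := eqVneq c 0; first by rewrite scale0r scaler0 l0 scaler0.
  (* A multiple of [e1] is not independent of [e1], so the factor is carried from [e1] to [e2] and
     from there to [c *: e1]. *)
  apply: (l_scale_eq (x := e2)); last exact: l_scale_eq E1.
  by apply: indep_sym; apply: indep_scale.
have [||| sigma sigmaE] := @exists_rmorphism F s.
- by apply: (scaler_vecI e1_0); rewrite -sE !scale1r.
- by move=> a b; apply: (scaler_vecI e1_0); rewrite scalerDl -!sE scalerDl l_add.
- by move=> a b; apply: (scaler_vecI e1_0); rewrite -scalerA -!sE scalerA.
exists sigma => [b|]; last by split=> // a x; rewrite sigmaE.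
have [a] := l_scale_onto e1 b; rewrite sE => /(scaler_vecI e1_0) E.
by exists a; rewrite sigmaE.
Qed.

End FundamentalTheoremOfAffineGeometry.

(** * Matrices of rank one, full-rank matrices and kernels *)

Section RankOne.

Variable F : fieldType.

Lemma cV_functional m (u : 'cV[F]_m) : u != 0 -> exists z : 'rV_m, z *m u = 1%:M.
Proof.
case/matrix0Pn=> i [j]; rewrite ord1 => ui.
exists ((u i 0)^-1 *: delta_mx 0 i).
rewrite -scalemxAl -rowE [row i u]mx11_scalar mxE.
by rewrite scale_scalar_mx mulVf.
Qed.

Lemma rV_functional n (w : 'rV[F]_n) : w != 0 -> exists z : 'cV_n, w *m z = 1%:M.
Proof.
rewrite -trmx_eq0 => /cV_functional[z E].
by exists z^T; apply: trmx_inj; rewrite trmx_mul trmxK E tr_scalar_mx.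
Qed.

Lemma mulmx_cV_inj m n (A B : 'M[F]_(m, n)) :
  (forall x : 'cV_n, A *m x = B *m x) -> A = B.
Proof.
move=> AB; apply: trmx_inj; apply/row_matrixP => j.
by rewrite -!tr_col !colE AB.
Qed.

Lemma mulmx11r m (u : 'cV[F]_m) (a : 'M_1) : u *m a = a 0 0 *: u.
Proof. by rewrite {1}[a]mx11_scalar mul_mx_scalar. Qed.

Lemma mulmx11l n (a : 'M_1) (w : 'rV[F]_n) : a *m w = a 0 0 *: w.
Proof. by rewrite {1}[a]mx11_scalar mul_scalar_mx. Qed.

Lemma mul_cV_rV_eq0 m n (u : 'cV[F]_m) (w : 'rV[F]_n) :
  (u *m w == 0) = (u == 0) || (w == 0).
Proof.
apply/idP/orP => [|[/eqP->|/eqP->]]; rewrite ?mul0mx ?mulmx0 //.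
have [->|/cV_functional[z zu]] := eqVneq u 0; first by left.
move/eqP/(congr1 (mulmx z)); rewrite mulmxA zu mul1mx mulmx0 => ->.
by right.
Qed.

Lemma indep_tr m n (A B : 'M[F]_(m, n)) : indep A B -> indep A^T B^T.
Proof.
move=> AB a b; rewrite -!linearZ -linearD => /(canRL (@trmxK _ _ _)).
by rewrite trmx0 => /AB.
Qed.

Lemma indep_row_free n (a b : 'rV[F]_n) : indep a b -> row_free (col_mx a b).
Proof.
move=> ab; apply: inj_row_free => v; rewrite -[v]hsubmxK mul_row_col.
rewrite !mulmx11l => /ab[a0 b0].
rewrite [lsubmx v]mx11_scalar [rsubmx v]mx11_scalar a0 b0.
by rewrite !raddf0 row_mx0.
Qed.

(** The sum is the product of a two-column matrix with independent columns and a two-row matrix with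
    independent rows. *)
Lemma rank_indep_sum m n (p b : 'cV[F]_m) (a q : 'rV[F]_n) :
  indep p b -> indep a q -> \rank (p *m a + b *m q)%R = 2.
Proof.
move=> pb aq; rewrite -mul_row_col mxrankMfree ?indep_row_free //.
by rewrite -mxrank_tr tr_row_mx; apply/eqP/indep_row_free/indep_tr.
Qed.

Lemma rank1_factor m n (A : 'M[F]_(m, n)) :
  (\rank A <= 1)%N -> exists (u : 'cV_m) (w : 'rV_n), A = u *m w.
Proof.
case: (posnP (\rank A)) => [/eqP|r0 r1].
  by rewrite mxrank_eq0 => /eqP-> _; exists 0, 0; rewrite mul0mx.
have r : \rank A = 1%N by apply/eqP; rewrite eqn_leq r1.
move: (col_base A) (row_base A) (mulmx_base A); rewrite r => u w <-.
by exists u, w.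
Qed.

Lemma rank_cV_rV m n (u : 'cV[F]_m) (w : 'rV[F]_n) :
  u != 0 -> w != 0 -> \rank (u *m w) = 1%N.
Proof.
move=> u0 w0; apply/eqP; rewrite eqn_leq.
rewrite (leq_trans (mxrankM_maxl _ _)) ?rank_leq_col //=.
by rewrite lt0n mxrank_eq0 mul_cV_rV_eq0 negb_or u0.
Qed.

Lemma cV_rV_of_columns m n (A : 'M[F]_(m, n)) (u : 'cV_m) :
  u != 0 -> (forall x : 'cV_n, exists c, A *m x = c *: u) ->
  exists a : 'rV_n, A = u *m a.
Proof.
move=> /cV_functional[z zu] Au; exists (z *m A); apply: mulmx_cV_inj => x.
case: (Au x) => c; rewrite -!mulmxA => ->.
by rewrite -scalemxAr zu -scalemxAr mulmx1.
Qed.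

(** If [d *m z = 1], then [x - z *m (d *m x)] lies in the kernel of [d]; hence the multiplier is the
    value of [a] at [z]. *)
Lemma rV_collinear_ker n (a d : 'rV[F]_n) : d != 0 ->
  (forall x : 'cV_n, d *m x = 0 -> a *m x = 0) -> exists c, a = c *: d.
Proof.
move=> /rV_functional[z dz] da; exists ((a *m z) 0 0).
rewrite -mulmx11l; apply: mulmx_cV_inj => x; have := da (x - z *m (d *m x)).
rewrite !mulmxBr !mulmxA dz mul1mx subrr => /(_ erefl) /eqP.
by rewrite subr_eq0 => /eqP.
Qed.

Lemma full_rankP m n (A : 'M[F]_(m, n)) :
  \rank A = n <-> forall x : 'cV_n, A *m x = 0 -> x = 0.
Proof.
rewrite -mxrank_tr; split=> [/eqP Afree x|Ainj].
  move/(congr1 trmx); rewrite trmx_mul trmx0 => /eqP.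
  by rewrite mulmx_free_eq0 // trmx_eq0 => /eqP.
apply/eqP; apply: inj_row_free => v /(congr1 trmx).
rewrite trmx_mul trmxK trmx0 => /Ainj /(congr1 trmx).
by rewrite trmxK trmx0.
Qed.

Lemma not_full_rank m n (A : 'M[F]_(m, n)) :
  \rank A <> n -> exists2 x : 'cV_n, x != 0 & A *m x = 0.
Proof.
move=> nA; apply: NNPP => nex; apply: nA; apply/full_rankP => x Ax.
by apply/eqP; apply: NNPP => /negP x0; apply: nex; exists x.
Qed.

(** An injective linear map can be prescribed on independent vectors with independent values. Embed
    the shorter rows by [pid_mx] and extend the partial map to an invertible [g]. *)
Lemma exists_full_rank m n k (U : 'M[F]_(k, n)) (V : 'M[F]_(k, m)) :
  (n <= m)%N -> row_free U -> row_free V ->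
  exists2 Z : 'M[F]_(m, n), \rank Z = n & U *m Z^T = V.
Proof.
move=> nm Ufree Vfree.
pose e : 'M[F]_(n, m) := pid_mx n.
have efree : row_free e by rewrite /row_free rank_pid_mx.
have Uefree : row_free (U *m e) by rewrite /row_free mxrankMfree.
have E : U *m e *m (pinvmx (U *m e) *m V) = V.
  by rewrite mulmxA (mulmxVp Uefree) mul1mx.
have [|g gu] := @complete_unitmx _ _ _ (U *m e) (pinvmx (U *m e) *m V).
  by rewrite E (eqP Uefree) (eqP Vfree).
rewrite E => VE; exists (e *m g)^T; last by rewrite trmxK mulmxA.
by rewrite mxrank_tr mxrankMfree ?row_free_unit // (eqP efree).
Qed.

Lemma exists_indep_cV n (x : 'cV[F]_n) : (1 < n)%N -> x != 0 ->
  exists y : 'cV[F]_n, indep x y.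
Proof.
move=> n1 x0; apply: NNPP => nex.
have dep y : exists c, y = c *: x.
  by case: (dep_or_indep y x0) => // xy; case: nex; exists y.
pose i0 := Ordinal (ltn_trans (ltnSn 0) n1); pose i1 := Ordinal n1.
have [c0 E0] := dep (delta_mx i0 0); have [c1 E1] := dep (delta_mx i1 0).
have := congr1 (fun z : 'cV_n => z i0 0) E0; rewrite !mxE !eqxx /= => e00.
have := congr1 (fun z : 'cV_n => z i1 0) E0; rewrite !mxE !eqxx /= => e01.
have := congr1 (fun z : 'cV_n => z i1 0) E1; rewrite !mxE !eqxx /= => e11.
move/esym/eqP: e01; rewrite mulf_eq0 => /orP[]/eqP E.
  by move/eqP: e00; rewrite E mul0r oner_eq0.
by move/eqP: e11; rewrite E mulr0 oner_eq0.
Qed.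

Lemma indep_cV n : (1 < n)%N -> exists x y : 'cV[F]_n, indep x y.
Proof.
move=> n1; have x0 : (const_mx 1 : 'cV[F]_n) != 0.
  by apply/matrix0Pn; exists (Ordinal n1), 0; rewrite mxE oner_eq0.
by have [y xy] := exists_indep_cV n1 x0; exists (const_mx 1), y.
Qed.

Lemma indep_rV n : (1 < n)%N -> exists x y : 'rV[F]_n, indep x y.
Proof. by case/indep_cV=> x [y xy]; exists x^T, y^T; apply: indep_tr. Qed.

(** Every matrix is a sum of scaled matrix units, and each of these is a column times a row. *)
Lemma mx_rank1_ind m n (P : 'M[F]_(m, n) -> Prop) :
  P 0 -> (forall A (x : 'cV_m) (w : 'rV_n), P A -> P (A + x *m w)) -> forall A, P A.
Proof.
move=> P0 PD A; rewrite [A]matrix_sum_delta pair_bigA /=.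
apply: big_rec => // -[i j] B _ PB /=; rewrite addrC.
by rewrite -(mul_delta_mx (0 : 'I_1)) scalemxAl; apply: PD.
Qed.

End RankOne.

(** * Lines in rank-one directions, characterised by full rank *)

Section Adjacency.

Variables (F : fieldType) (m n : nat).
Hypotheses (hmn : (n <= m)%N) (hn : (2 <= n)%N).
Implicit Types A B R X : 'M[F]_(m, n).

(* For distinct A, B, R this says that A and B are adjacent and that R lies on
   the line through them. *)
Definition between R A B : Prop :=
  forall X, \rank (R - X) = n -> \rank (A - X) = n \/ \rank (B - X) = n.

(** If [A - X] kills [x] and [B - X] kills [y], then the third matrix minus [X] sends both [x] and
    [y] into the line of [u], where [B - A = u *m v]; this contradicts its injectivity. *)
Lemma line_between A B t : \rank (A - B) = 1%N -> t != 0 -> t != 1 ->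
  between (A + t *: (B - A)) A B.
Proof.
move=> AB1 t0 t1 X /full_rankP Rfull.
have [u [v D]] : exists (u : 'cV_m) (v : 'rV_n), B - A = u *m v.
  by apply: rank1_factor; rewrite -opprB mxrank_opp AB1.
case: (classic (\rank (A - X) = n)) => [|/not_full_rank[x x0 Ax]]; first by left.
case: (classic (\rank (B - X) = n)) => [|/not_full_rank[y y0 By]]; first by right.
exfalso.
have Zx : (A + t *: (B - A) - X) *m x = (t * (v *m x) 0 0) *: u.
  by rewrite addrAC mulmxDl Ax add0r D -scalemxAl -mulmxA mulmx11r scalerA.
have Zy : (A + t *: (B - A) - X) *m y = - (((1 - t) * (v *m y) 0 0) *: u).
  have -> : A + t *: (B - A) - X = (B - X) - (1 - t) *: (B - A).
    rewrite scalerBl scale1r opprB addrCA opprB addrAC addrC.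
    by congr (_ + _); rewrite [RHS]addrC addrA subrK.
  by rewrite mulmxBl By add0r D -scalemxAl -mulmxA mulmx11r scalerA.
set a := (v *m x) 0 0 in Zx; set b := (v *m y) 0 0 in Zy.
(* The combination of [x] and [y] whose images cancel must vanish. Applying [v] to it leaves
   [a * b = 0], so [x] or [y] itself lies in the kernel. *)
have /Rfull/(congr1 (mulmx v)) : (A + t *: (B - A) - X) *m
   (((1 - t) * b) *: x + (t * a) *: y) = 0.
  rewrite mulmxDr -!scalemxAr Zx Zy scalerN !scalerA [t * a * _]mulrC.
  exact: subrr.
rewrite mulmx0 mulmxDr -!scalemxAr [v *m x]mx11_scalar [v *m y]mx11_scalar.
rewrite -/a -/b !scale_scalar_mx -raddfD /= => /matrixP/(_ 0 0).
rewrite !mxE mulr1n -!mulrA [b * a]mulrC -mulrDl subrK mul1r => /eqP.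
rewrite mulf_eq0 => /orP[]/eqP ab0.
  by case/eqP: x0; apply: Rfull; rewrite Zx ab0 mulr0 scale0r.
by case/eqP: y0; apply: Rfull; rewrite Zy ab0 mulr0 scale0r oppr0.
Qed.

(** For [y] independent of [x] this is the hypothesis; a multiple of [x] is the difference of two
    vectors independent of [x]. *)
Let image_line A B (x : 'cV[F]_n) : A *m x != 0 ->
  (forall x y : 'cV[F]_n, indep x y -> ~ indep (A *m x) (B *m y)) ->
  forall y, exists c, B *m y = c *: (A *m x).
Proof.
move=> Ax0 dep.
have x0 : x != 0 by apply: contraNneq Ax0 => ->; rewrite mulmx0.
have dep1 y : indep x y -> exists c, B *m y = c *: (A *m x).
  by case: (dep_or_indep (B *m y) Ax0) => // i xy; case: (dep x y).
move=> y; case: (dep_or_indep y x0) => [[c ->]|]; last exact: dep1.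
have [z xz] := exists_indep_cV hn x0.
have [c1 E1] := dep1 z xz.
have [|c2 E2] := dep1 (z + c *: x); first exact: indep_add.
by exists (c2 - c1); rewrite scalerBl -E1 -E2 -mulmxBr [z + _]addrC addrK.
Qed.

Lemma between_line A B R : A != B -> R != A -> R != B -> between R A B ->
  \rank (A - B) = 1%N /\ exists t, R = A + t *: (B - A).
Proof.
move=> AB RA RB bet.
(* Test [between] at [X = R + Z]: then [R - X = - Z] has full rank, while [A - X] kills [x] and
   [B - X] kills [y]. *)
have noZ (Z : 'M[F]_(m, n)) (x y : 'cV[F]_n) : \rank Z = n -> x != 0 -> y != 0 ->
    Z *m x = (A - R) *m x -> Z *m y = (B - R) *m y -> False.
  move=> Zfull x0 y0 Zx Zy; case: (bet (R + Z)).
  - by rewrite opprD addNKr mxrank_opp.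
  - move/full_rankP => /(_ x); rewrite opprD addrA mulmxBl Zx subrr => /(_ erefl).
    exact/eqP.
  - move/full_rankP => /(_ y); rewrite opprD addrA mulmxBl Zy subrr => /(_ erefl).
    exact/eqP.
have dep (x y : 'cV[F]_n) : indep x y -> ~ indep ((A - R) *m x) ((B - R) *m y).
  move=> xy pq.
  have [||Z Zfull] := exists_full_rank (U := col_mx x^T y^T)
      (V := col_mx ((A - R) *m x)^T ((B - R) *m y)^T) hmn.
  - exact/indep_row_free/indep_tr.
  - exact/indep_row_free/indep_tr.
  rewrite mul_col_mx -!trmx_mul => /eq_col_mx[/trmx_inj Zx /trmx_inj Zy].
  apply: (noZ Z x y) => //; first exact: indep_neq0 xy.
  exact: indep_neq0 (indep_sym xy).
(* A common nonzero value at [x] could be taken by a full-rank [Z], against [noZ] with [y = x]. *)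
have agree (x : 'cV[F]_n) : (A - R) *m x = (B - R) *m x -> (A - R) *m x = 0.
  move=> E; apply/eqP; apply: contraPT (erefl true) => p0 _.
  have x0 : x != 0 by apply: contraNneq p0 => ->; rewrite mulmx0.
  have rf k (v : 'cV[F]_k) : v != 0 -> row_free v^T.
    by move=> v0; rewrite /row_free mxrank_tr eqn_leq rank_leq_col lt0n mxrank_eq0.
  have [Z Zfull] := exists_full_rank hmn (rf _ _ x0) (rf _ _ p0).
  rewrite -trmx_mul => /trmx_inj Zx.
  by apply: (noZ Z x x) => //; rewrite -E.
have nz (X : 'M[F]_(m, n)) : X != 0 -> exists x : 'cV[F]_n, X *m x != 0.
  move=> X0; apply: NNPP => nex; case/eqP: X0; apply: mulmx_cV_inj => x.
  by rewrite mul0mx; apply/eqP; apply: NNPP => /negP Xx; apply: nex; exists x.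
have [x Ax0] : exists x : 'cV[F]_n, (A - R) *m x != 0.
  by apply: nz; rewrite subr_eq0 eq_sym.
have [y By0] : exists x : 'cV[F]_n, (B - R) *m x != 0.
  by apply: nz; rewrite subr_eq0 eq_sym.
have Bu := image_line Ax0 dep.
have Av : forall z, exists c, (A - R) *m z = c *: ((B - R) *m y).
  by apply: image_line By0 _ => z1 z2 /indep_sym i12 /indep_sym; apply: dep.
have [b Bb] := cV_rV_of_columns Ax0 Bu.
have [a Aa] : exists a, A - R = (A - R) *m x *m a.
  apply: cV_rV_of_columns => // z; have [c ->] := Av z.
  by have [d ->] := Bu y; exists (c * d); rewrite scalerA.
move: Ax0 Aa Bb; set u := (A - R) *m x => u0 Aa Bb.
have D : A - B = u *m (a - b).
  by rewrite mulmxBr -Aa -Bb opprB addrA subrK.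
have d0 : a - b != 0.
  by apply: contraNneq AB => d0; rewrite -subr_eq0 D d0 mulmx0.
split; first by rewrite D rank_cV_rV.
(* On the kernel of [a - b] the matrices [A - R] and [B - R] agree, hence both vanish there by
   [agree]; so [a] is a multiple of [a - b]. *)
have [c E] : exists c, a = c *: (a - b).
  apply: rV_collinear_ker => // z /(congr1 (mulmx u)).
  rewrite mulmx0 mulmxA -D => ABz.
  have : (A - R) *m z = 0.
    apply: agree; apply/eqP; rewrite -subr_eq0 -mulmxBl opprB addrA subrK.
    by rewrite ABz.
  rewrite Aa -mulmxA => /eqP; rewrite mul_cV_rV_eq0 (negPf u0) /= => /eqP //.
exists c; have ARc : A - R = c *: (A - B) by rewrite Aa E -scalemxAr -D.
by rewrite -[B - A]opprB scalerN -ARc opprB addrC subrK.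
Qed.

End Adjacency.

(** * Semilinear maps with values of rank one *)

Section SemilinearRankOne.

Variables (F : fieldType) (sigma : {rmorphism F -> F}).
Hypothesis sigma_onto : forall b, exists a, sigma a = b.

Lemma semilinear_indep (V W : lmodType F) (l : V -> W) (x y : V) :
  semilinear_map sigma l -> (forall x, x != 0 -> l x != 0) ->
  indep x y -> indep (l x) (l y).
Proof.
move=> [lD lZ] l_neq0 xy a b; have [a' <-] := sigma_onto a.
have [b' <-] := sigma_onto b; rewrite -!lZ -lD => /eqP E.
have /xy[-> ->] : a' *: x + b' *: y = 0; last by rewrite !rmorph0.
by apply/eqP; apply: contraTT E; apply: l_neq0.
Qed.

Lemma semilinear0 (V W : lmodType F) (l : V -> W) : semilinear_map sigma l -> l 0 = 0.
Proof. by case=> _ lZ; rewrite -(scale0r (0 : V)) lZ rmorph0 scale0r. Qed.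

Section OneFactor.

Variables (p q : nat).

Definition common_col (V : Type) (l : V -> 'M[F]_(p, q)) : Prop :=
  exists u : 'cV_p, forall v, exists a : 'rV_q, l v = u *m a.

Definition common_row (V : Type) (l : V -> 'M[F]_(p, q)) : Prop :=
  exists a : 'rV_q, forall v, exists u : 'cV_p, l v = u *m a.

End OneFactor.

Lemma rank_sum_dep p q (u b : 'cV[F]_p) (a c : 'rV[F]_q) :
  u != 0 -> a != 0 -> (\rank (u *m a + b *m c)%R <= 1)%N ->
  (exists k, b = k *: u) \/ (exists k, c = k *: a).
Proof.
move=> u0 a0 r; case: (dep_or_indep b u0) => [|ub]; first by left.
case: (dep_or_indep c a0) => [|ac]; first by right.
by move: r; rewrite rank_indep_sum.
Qed.

Section TypeOfMap.

Variables (p q : nat) (V : lmodType F) (e1 e2 : V).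
Hypothesis e12 : indep (V := V) e1 e2.

Definition rank1_semilinear p q (l : V -> 'M[F]_(p, q)) : Prop :=
  semilinear_map sigma l /\ forall v, v != 0 -> \rank (l v) = 1%N.

Lemma rank1_semilinear_neq0 p' q' (l : V -> 'M[F]_(p', q')) v :
  rank1_semilinear l -> v != 0 -> l v != 0.
Proof. by case=> _ lr v0; rewrite -mxrank_eq0 lr. Qed.

Lemma rank1_semilinear_le1 p' q' (l : V -> 'M[F]_(p', q')) v :
  rank1_semilinear l -> (\rank (l v) <= 1)%N.
Proof.
case=> ls lr; have [->|v0] := eqVneq v 0; last by rewrite lr.
by rewrite (semilinear0 ls) mxrank0.
Qed.

Lemma rank1_semilinear_indep p' q' (l : V -> 'M[F]_(p', q')) x y :
  rank1_semilinear l -> indep x y -> indep (l x) (l y).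
Proof.
move=> lr; apply: semilinear_indep; first by case: lr.
by move=> v; apply: rank1_semilinear_neq0.
Qed.

Lemma rank1_semilinear_tr p' q' (l : V -> 'M[F]_(p', q')) :
  rank1_semilinear l -> rank1_semilinear (fun v => (l v)^T).
Proof.
move=> [[lD lZ] lr]; split=> [|v v0]; last by rewrite mxrank_tr lr.
by split=> [x y|a x]; rewrite ?lD ?lZ linearE.
Qed.

Lemma mulmx_nz m' k n' (u : 'M[F]_(m', k)) (w : 'M_(k, n')) :
  u *m w != 0 -> u != 0 /\ w != 0.
Proof.
by move=> uw; split; apply: contraNneq uw => ->; rewrite ?mul0mx ?mulmx0.
Qed.

(** If the column factor of [l v] were not a multiple of [u], the ranks of [l (e1 + v)] and
    [l (e2 + v)] would make its row factor proportional to both of the independent rows [a1] and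
    [a2], hence zero. *)
Lemma common_col_of_two p' q' (l : V -> 'M[F]_(p', q'))
    (u : 'cV_p') (a1 a2 : 'rV_q') :
  rank1_semilinear l -> l e1 = u *m a1 -> l e2 = u *m a2 -> common_col l.
Proof.
move=> lr E1 E2; exists u => v.
have l_neq0 := rank1_semilinear_neq0 lr.
have lD : {morph l : x y / x + y} by case: lr => -[].
have [u0 a10] : u != 0 /\ a1 != 0.
  by apply: mulmx_nz; rewrite -E1 l_neq0 ?(indep_neq0 e12).
have [_ a20] : u != 0 /\ a2 != 0.
  by apply: mulmx_nz; rewrite -E2 l_neq0 ?(indep_neq0 (indep_sym e12)).
have a12 : indep a1 a2.
  apply: indepP => // -[c E].
  by apply: (indepF (rank1_semilinear_indep lr e12) (a := c)); rewrite E1 E2 E scalemxAr.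
have [b [a3 E3]] := rank1_factor (rank1_semilinear_le1 v lr).
have r1 := rank1_semilinear_le1 (e1 + v) lr; rewrite lD E1 E3 in r1.
have r2 := rank1_semilinear_le1 (e2 + v) lr; rewrite lD E2 E3 in r2.
have dep k : b = k *: u -> exists a, l v = u *m a.
  by move=> Eb; exists (k *: a3); rewrite E3 Eb -scalemxAl scalemxAr.
case: (rank_sum_dep u0 a10 r1) => [[k /dep]//|[k1 E31]].
case: (rank_sum_dep u0 a20 r2) => [[k /dep]//|[k2 E32]].
have [] := a12 k1 (- k2); first by rewrite -E31 scaleNr -E32 subrr.
by move=> k10 _; exists 0; rewrite E3 E31 k10 scale0r !mulmx0.
Qed.

Lemma common_row_tr p' q' (l : V -> 'M[F]_(p', q')) :
  common_col (fun v => (l v)^T) -> common_row l.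
Proof.
case=> u lu; exists u^T => v; have [a E] := lu v; exists a^T.
by apply: trmx_inj; rewrite E trmx_mul !trmxK.
Qed.

(** Since [l e1 + l e2] has rank at most one, the two values have proportional columns or
    proportional rows; the second case is the first one transposed. *)
Lemma common_col_or_row (l : V -> 'M[F]_(p, q)) :
  rank1_semilinear l -> common_col l \/ common_row l.
Proof.
move=> lr; have lD : {morph l : x y / x + y} by case: lr => -[].
have l_neq0 := rank1_semilinear_neq0 lr.
have [u1 [a1 E1]] := rank1_factor (rank1_semilinear_le1 e1 lr).
have [u2 [a2 E2]] := rank1_factor (rank1_semilinear_le1 e2 lr).
have [u10 a10] : u1 != 0 /\ a1 != 0.
  by apply: mulmx_nz; rewrite -E1 l_neq0 ?(indep_neq0 e12).
have r := rank1_semilinear_le1 (e1 + e2) lr; rewrite lD E1 E2 in r.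
case: (rank_sum_dep u10 a10 r) => -[k E]; [left|right].
  by apply: (common_col_of_two lr E1 (a2 := k *: a2)); rewrite E2 E -scalemxAl scalemxAr.
apply: common_row_tr; apply: (common_col_of_two (rank1_semilinear_tr lr)).
  by rewrite E1 trmx_mul.
by rewrite E2 trmx_mul E linearZ -scalemxAl scalemxAr.
Qed.

(** A sum of rank at most one puts [l1 v] or [l2 v] on the line of [u *m a]. Among the pairwise
    independent [e1], [e2], [e1 + e2], two fall under the same map, whose values there are
    independent. *)
Lemma common_col_row_sum (l1 l2 : V -> 'M[F]_(p, q)) :
  rank1_semilinear l1 -> rank1_semilinear l2 -> common_col l1 -> common_row l2 ->
  ~ (forall v, (\rank (l1 v + l2 v)%R <= 1)%N).
Proof.
move=> r1 r2 [u lu] [a la] r.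
have key v : v != 0 -> (exists k, l1 v = k *: (u *m a)) \/ (exists k, l2 v = k *: (u *m a)).
  move=> v0; have [b E1] := lu v; have [c E2] := la v.
  have [u0 b0] : u != 0 /\ b != 0.
    by apply: mulmx_nz; rewrite -E1 (rank1_semilinear_neq0 r1).
  have [c0 a0] : c != 0 /\ a != 0.
    by apply: mulmx_nz; rewrite -E2 (rank1_semilinear_neq0 r2).
  have rv := r v; rewrite E1 E2 addrC in rv.
  case: (rank_sum_dep c0 a0 rv) => -[k E]; [right|left].
    have k0 : k != 0 by apply: contraNneq u0 => k0; rewrite E k0 scale0r.
    by exists k^-1; rewrite E2 E -scalemxAl scalerA mulVf // scale1r.
  by exists k; rewrite E1 E scalemxAr.
have dep l v w (lr : rank1_semilinear l) (vw : indep v w) :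
    (exists k, l v = k *: (u *m a)) -> (exists k, l w = k *: (u *m a)) -> False.
  move=> [k1 Ek1] [k2 Ek2]; have i := rank1_semilinear_indep lr vw.
  have k10 : k1 != 0.
    by apply: contraTneq (indep_neq0 i) => k0; rewrite Ek1 k0 scale0r eqxx.
  by apply: (indepF i (a := k2 / k1)); rewrite Ek1 scalerA divfK.
have i1 : indep e1 (e1 + e2) by rewrite -{2}[e1]scale1r addrC; apply: indep_add.
have i2 : indep e2 (e1 + e2).
  by rewrite -{2}[e2]scale1r; apply: indep_add; apply: indep_sym.
have n1 := indep_neq0 e12; have n2 := indep_neq0 (indep_sym e12).
have n3 := indep_neq0 (indep_sym i1).
case: (key _ n1) => k1; case: (key _ n2) => k2; case: (key _ n3) => k3.
- exact: (dep _ _ _ r1 e12).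
- exact: (dep _ _ _ r1 e12).
- exact: (dep _ _ _ r1 i1).
- exact: (dep _ _ _ r2 i2).
- exact: (dep _ _ _ r1 i2).
- exact: (dep _ _ _ r2 i1).
- exact: (dep _ _ _ r2 e12).
- exact: (dep _ _ _ r2 e12).
Qed.

End TypeOfMap.

(** * Bisemilinear maps with values of rank one *)

Section Bisemilinear.

Variables (V U : lmodType F).

Definition rank1_bisemilinear p q (psi : V -> U -> 'M[F]_(p, q)) : Prop :=
  [/\ forall x, semilinear_map sigma (psi x),
      forall w, semilinear_map sigma (psi^~ w)
    & forall x w, x != 0 -> w != 0 -> \rank (psi x w) = 1%N].

Definition splits p q (psi : V -> U -> 'M[F]_(p, q)) : Prop :=
  exists (f : V -> 'cV_p) (g : U -> 'rV_q),
    [/\ semilinear_map sigma f, semilinear_map sigma g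
      & forall x w, psi x w = f x *m g w].

Variables (x1 x2 : V) (w1 w2 : U).
Hypotheses (x12 : indep (V := V) x1 x2) (w12 : indep (V := U) w1 w2).

Lemma rank1_bisemilinear_tr p q (psi : V -> U -> 'M[F]_(p, q)) :
  rank1_bisemilinear psi -> rank1_bisemilinear (fun x w => (psi x w)^T).
Proof.
move=> [psil psir psi1]; split=> [x|w|x w x0 w0]; last by rewrite mxrank_tr psi1.
- by have [D Z] := psil x; split=> [u v|a u]; rewrite ?D ?Z linearE.
- by have [D Z] := psir w; split=> [u v|a u]; rewrite ?D ?Z linearE.
Qed.

(** [f] is read off the slice at [w1] and [g] off the slice at [x1]. The common columns and rows
    give [psi x w] up to a scalar, and additivity in [x] forces that scalar to be 1. *)
Lemma common_col_splits p q (psi : V -> U -> 'M[F]_(p, q)) :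
  rank1_bisemilinear psi ->
  (forall x, x != 0 -> common_col (psi x)) ->
  (forall w, w != 0 -> common_row (psi^~ w)) -> splits psi.
Proof.
move=> [psil psir psi1] cols rows.
have psi_neq0 x w : x != 0 -> w != 0 -> psi x w != 0.
  by move=> x0 w0; rewrite -mxrank_eq0 psi1.
have x10 := indep_neq0 x12; have w10 := indep_neq0 w12.
have [a la] := rows _ w10.
have a0 : a != 0.
  have [u E] := la x1; have := psi_neq0 _ _ x10 w10.
  by rewrite E => /mulmx_nz[].
have [z az] := rV_functional a0.
pose f x := psi x w1 *m z.
have fE x : psi x w1 = f x *m a.
  by have [u E] := la x; rewrite /f E -[u *m a *m z]mulmxA az mulmx1.
have f_neq0 x : x != 0 -> f x != 0.
  by move=> x0; have := psi_neq0 _ _ x0 w10; rewrite fE => /mulmx_nz[].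
have colE x w : x != 0 -> exists b, psi x w = f x *m b.
  move=> x0; have [u lu] := cols _ x0; have [b ->] := lu w.
  have [c E] := lu w1; have := f_neq0 _ x0; rewrite /f E -mulmxA mulmx11r.
  set k := (c *m z) 0 0 => ku; have k0 : k != 0.
    by apply: contraNneq ku => ->; rewrite scale0r.
  by exists (k^-1 *: b); rewrite -scalemxAl -scalemxAr scalerA mulfV // scale1r.
have [y fy] := cV_functional (f_neq0 _ x10).
pose g w := y *m psi x1 w.
have gE w : psi x1 w = f x1 *m g w.
  by have [b E] := colE x1 w x10; rewrite /g E [y *m _]mulmxA fy mul1mx.
have g_neq0 w : w != 0 -> g w != 0.
  by move=> w0; have := psi_neq0 _ _ x10 w0; rewrite gE => /mulmx_nz[].
have fS : semilinear_map sigma f.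
  have [D Z] := psir w1.
  by split=> [u v|b u]; rewrite /f ?D ?Z ?mulmxDl // scalemxAl.
have gS : semilinear_map sigma g.
  have [D Z] := psil x1.
  by split=> [u v|b u]; rewrite /g ?D ?Z ?mulmxDr // scalemxAr.
(* The row factor of [psi x w] over [f x] and the row [g w] are both multiples of the common row of
   [psi^~ w]. *)
have scal x w : x != 0 -> w != 0 -> exists c, psi x w = c *: (f x *m g w).
  move=> x0 w0; have [b E] := colE x w x0; have [c lc] := rows _ w0.
  have [u E'] := lc x; have [v E''] := lc x1.
  have [y' fy'] := cV_functional (f_neq0 _ x0).
  have Eb : b = (y' *m u) 0 0 *: c.
    by rewrite -mulmx11l -mulmxA -E' E mulmxA fy' mul1mx.
  have Eg : g w = (y *m v) 0 0 *: c by rewrite -mulmx11l -mulmxA -E''.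
  have k0 : (y *m v) 0 0 != 0.
    by apply: contraNneq (g_neq0 _ w0) => k0; rewrite Eg k0 scale0r.
  exists ((y' *m u) 0 0 / (y *m v) 0 0).
  by rewrite E Eg Eb -!scalemxAr scalerA divfK.
move: f g fE f_neq0 colE fy gE g_neq0 fS gS scal => f g fE f_neq0 colE fy gE g_neq0 fS gS scal.
exists f, g; split=> // x w.
have [->|w0] := eqVneq w 0.
  by rewrite (semilinear0 (psil x)) (semilinear0 gS) mulmx0.
case: (dep_or_indep x x10) => [[c ->]|x1x].
  by case: (psir w) => _ ->; case: fS => _ ->; rewrite -scalemxAl gE.
have [c E] := scal _ _ (indep_neq0 (indep_sym x1x)) w0.
have i : indep (x1 + x) x1.
  by apply: indep_sym; rewrite -{2}[x1]scale1r addrC; apply: indep_add.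
(* Expanding [psi (x1 + x) w] over the independent [f x1] and [f x] gives [d = 1] and [c = d]. *)
have [d] := scal _ _ (indep_neq0 i) w0.
case: (psir w) => -> _; rewrite E gE; case: (fS) => -> _.
have [z' gz'] := rV_functional (g_neq0 _ w0).
move/(congr1 (mulmx^~ z')); rewrite -!scalemxAl !mulmxDl -!scalemxAl -!mulmxA gz' !mulmx1.
move/eqP; rewrite scalerDr -subr_eq0 opprD addrACA.
rewrite -[X in X - _ + _]scale1r -!scalerBl => /eqP.
move/(semilinear_indep fS f_neq0 x1x) => [/eqP]; rewrite subr_eq0 => /eqP<- /eqP.
by rewrite subr_eq0 => /eqP->; rewrite scale1r.
Qed.

(** Slices of different types cannot coexist: [psi x w + psi x' w = psi (x + x') w] has rank at most
    one for all [w], against [common_col_row_sum]. *)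
Lemma common_col_all_or_row_all p q (psi : V -> U -> 'M[F]_(p, q)) :
  rank1_bisemilinear psi ->
  (forall x, x != 0 -> common_col (psi x)) \/ (forall x, x != 0 -> common_row (psi x)).
Proof.
move=> [psil psir psi1].
have r1 x : x != 0 -> rank1_semilinear (psi x) by move=> x0; split=> // w; apply: psi1.
have le1 x w : (\rank (psi x w) <= 1)%N.
  have [->|x0] := eqVneq x 0; first by rewrite (semilinear0 (psir w)) mxrank0.
  exact: rank1_semilinear_le1 (r1 _ x0).
have mixed x x' : x != 0 -> x' != 0 -> common_col (psi x) -> ~ common_row (psi x').
  move=> x0 x'0 c r; apply: (common_col_row_sum w12 (r1 _ x0) (r1 _ x'0) c r) => w.
  by case: (psir w) => D _; rewrite -D.
have x10 := indep_neq0 x12.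
case: (common_col_or_row w12 (r1 _ x10)) => c1; [left|right] => x x0.
  by case: (common_col_or_row w12 (r1 _ x0)) => // /(mixed _ _ x10 x0 c1).
by case: (common_col_or_row w12 (r1 _ x0)) => // /(mixed _ _ x0 x10)/(_ c1).
Qed.

(** Excludes the degenerate maps all of whose values share one column or one row. *)
Definition separates p q (psi : V -> U -> 'M[F]_(p, q)) : Prop :=
  forall x x' w w', indep x x' -> indep w w' ->
    (1 < \rank (psi x w - psi x' w')%R)%N.

(** If [psi^~ w] had a common column [u], the column of [psi x2] would be proportional to [u], and
    [psi x1 w - psi x2 w'] would have rank at most one. *)
Lemma common_col_rows p q (psi : V -> U -> 'M[F]_(p, q)) :
  rank1_bisemilinear psi -> separates psi ->
  (forall x, x != 0 -> common_col (psi x)) ->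
  forall w, w != 0 -> common_row (psi^~ w).
Proof.
move=> [psil psir psi1] sep cols w w0.
have lr : rank1_semilinear (psi^~ w).
  by split=> // x x0; apply: psi1.
case: (common_col_or_row x12 lr) => // -[u lu]; exfalso.
have [w' ww'] : exists w', indep w w'.
  case: (dep_or_indep w1 w0) => [[c E]|]; last by exists w1.
  exists w2; have c0 : c != 0.
    by apply: contraTneq (indep_neq0 w12) => c0; rewrite E c0 scale0r eqxx.
  have -> : w = c^-1 *: w1 by rewrite E scalerA mulVf // scale1r.
  by apply: indep_scale; rewrite ?invr_eq0.
have x20 := indep_neq0 (indep_sym x12).
have [v lv] := cols _ x20.
have [a E] := lu x2; have [b E'] := lv w; have [c E''] := lv w'.
have n0 : psi x2 w != 0 by rewrite -mxrank_eq0 psi1.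
have [u0 a0] : u != 0 /\ a != 0 by apply: mulmx_nz; rewrite -E.
have [_ b0] : v != 0 /\ b != 0 by apply: mulmx_nz; rewrite -E'.
have [z bz] := rV_functional b0.
have vE : v = (a *m z) 0 0 *: u.
  by rewrite -mulmx11r mulmxA -E E' -mulmxA bz mulmx1.
have [d Ed] := lu x1.
have := sep _ _ _ _ x12 ww'; rewrite Ed E'' vE -scalemxAl scalemxAr -mulmxBr.
by rewrite ltnNge (leq_trans (mxrankM_maxl _ _)) // rank_leq_col.
Qed.

Lemma rank1_bisemilinear_splits p q (psi : V -> U -> 'M[F]_(p, q)) :
  rank1_bisemilinear psi -> separates psi ->
  splits psi \/ splits (fun x w => (psi x w)^T).
Proof.
move=> psiS sep; case: (common_col_all_or_row_all psiS) => [cols|rows].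
  by left; apply: common_col_splits => //; apply: common_col_rows.
right; have sepT : separates (fun x w => (psi x w)^T).
  by move=> x x' w w' xx' ww'; rewrite -raddfB mxrank_tr sep.
have cols x : x != 0 -> common_col (fun w => (psi x w)^T).
  move=> /rows[a la]; exists a^T => w; have [u E] := la w; exists u^T.
  by rewrite E trmx_mul.
have psiT := rank1_bisemilinear_tr psiS.
by apply: common_col_splits => //; apply: common_col_rows.
Qed.

End Bisemilinear.

End SemilinearRankOne.

(** * Matrix form of semilinear and split maps *)

Section SemilinearMatrix.

Variables (F : fieldType) (sigma : {rmorphism F -> F}).
Hypothesis sigma_onto : forall b, exists a, sigma a = b.

Lemma onto_bijective : bijective sigma.
Proof.
have onto b : exists a, sigma a == b by have [a <-] := sigma_onto b; exists a.
exists (fun b => xchoose (onto b)) => [a|b]; last exact/eqP/(xchooseP (onto b)).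
exact/(fmorph_inj sigma)/eqP/(xchooseP (onto (sigma a))).
Qed.

Lemma semilinear_rV n q (g : 'rV[F]_n -> 'rV[F]_q) : semilinear_map sigma g ->
  exists S : 'M_(n, q), forall w, g w = map_mx sigma w *m S.
Proof.
move=> gS; have [gD gZ] := gS; exists (\matrix_i g (delta_mx 0 i)) => w.
rewrite mulmx_sum_row {1}[w]row_sum_delta (big_morph g gD (semilinear0 gS)).
by apply: eq_bigr => i _; rewrite gZ rowK mxE.
Qed.

Lemma semilinear_cV m p (f : 'cV[F]_m -> 'cV[F]_p) : semilinear_map sigma f ->
  exists T : 'M_(p, m), forall x, f x = T *m map_mx sigma x.
Proof.
move=> [fD fZ]; have [|S SE] := semilinear_rV (g := fun w => (f w^T)^T).
  by split=> [u v|a u]; rewrite linearE ?fD ?fZ linearE.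
exists S^T => x; apply: trmx_inj.
by rewrite -{1}[x]trmxK SE trmx_mul trmxK map_trmx.
Qed.

(** As [sigma] is onto, any row killed by [S] is the entrywise [sigma]-image of some row. *)
Lemma semilinear_row_free n q (S : 'M[F]_(n, q)) :
  (forall w : 'rV_n, w != 0 -> map_mx sigma w *m S != 0) -> row_free S.
Proof.
move=> S0; apply: inj_row_free => v vS.
have /fin_all_exists[h hE] j : exists a, sigma a = v 0 j by apply: sigma_onto.
have vE : v = map_mx sigma (\row_j h j).
  by apply/rowP => j; rewrite !mxE hE.
have [w0|/S0] := eqVneq (\row_j h j) 0; last by rewrite -vE vS eqxx.
by rewrite vE w0 map_mx0.
Qed.

Lemma splits_matrices m n p q (psi : 'cV[F]_m -> 'rV[F]_n -> 'M[F]_(p, q)) :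
  (1 < m)%N -> (1 < n)%N ->
  (forall x w, x != 0 -> w != 0 -> psi x w != 0) -> splits sigma psi ->
  exists (T : 'M_(p, m)) (S : 'M_(n, q)), [/\ row_free T^T, row_free S
    & forall x w, psi x w = T *m map_mx sigma (x *m w) *m S].
Proof.
move=> m1 n1 psi0 [f [g [/semilinear_cV[T fE] /semilinear_rV[S gE] psiE]]].
have [x1 [_ /indep_neq0 x10]] := indep_cV F m1.
have [w1 [_ /indep_neq0 w10]] := indep_rV F n1.
exists T, S; split=> [||x w].
- apply: semilinear_row_free => w w0; rewrite -trmx_eq0 in w0.
  have := psi0 _ _ w0 w10; rewrite psiE fE => /mulmx_nz[].
  by rewrite -trmx_eq0 trmx_mul map_trmx trmxK.
- by apply: semilinear_row_free => w w0; have := psi0 _ _ x10 w0; rewrite psiE gE => /mulmx_nz[].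
- by rewrite psiE fE gE map_mxM !mulmxA.
Qed.

End SemilinearMatrix.

(** * Comparison of two split maps *)

Section Uniqueness.

Variables (F : fieldType) (V U : lmodType F) (p q : nat).
Variables (sigma tau : {rmorphism F -> F}).

(** Agreement at [x0] gives [g = k *: g'] and agreement at [w0] gives [f' = k *: f], with the same
    [k]. The automorphisms need not be known to coincide. *)
Lemma splits_eq (psi psi' : V -> U -> 'M[F]_(p, q)) x0 w0 :
  splits sigma psi -> splits tau psi' -> psi x0 w0 != 0 ->
  psi x0 =1 psi' x0 -> psi^~ w0 =1 psi'^~ w0 -> forall x w, psi x w = psi' x w.
Proof.
move=> [f [g [_ _ E]]] [f' [g' [_ _ E']]] n0 eqx eqw x w.
have [fx0 gw0] : f x0 != 0 /\ g w0 != 0 by apply: mulmx_nz; rewrite -E.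
have [_ g'w0] : f' x0 != 0 /\ g' w0 != 0 by apply: mulmx_nz; rewrite -E' -eqx.
have [y fy] := cV_functional fx0; have [z gz] := rV_functional g'w0.
set k := (y *m f' x0) 0 0.
have gE v : g v = k *: g' v.
  by rewrite -mulmx11l -mulmxA -E' -eqx E mulmxA fy mul1mx.
have fE : f' x = k *: f x.
  rewrite -[f' x]mulmx1 -gz mulmxA -E' -[psi' x w0]eqw E gE -scalemxAr -scalemxAl.
  by rewrite -mulmxA gz mulmx1.
by rewrite E E' gE fE -scalemxAl scalemxAr.
Qed.

(** The values [psi x0 w] would share both the column [f x0] and the row [(f' x0)^T], so they would
    lie on one line. *)
Lemma splits_tr_neq (psi psi' : V -> U -> 'M[F]_(p, q)) x0 (w1 w2 : U) :
  splits sigma psi -> splits tau (fun x w => (psi' x w)^T) ->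
  psi x0 =1 psi' x0 -> ~ indep (psi x0 w1) (psi x0 w2).
Proof.
move=> [f [g [_ _ E]]] [f' [g' [_ _ E']]] eqx i.
have [fx0 _] : f x0 != 0 /\ g w1 != 0.
  by apply: mulmx_nz; rewrite -E (indep_neq0 i).
have [y fy] := cV_functional fx0.
have key w : psi x0 w = (y *m (g' w)^T) 0 0 *: (f x0 *m (f' x0)^T).
  have gE : g w = y *m psi x0 w by rewrite E mulmxA fy mul1mx.
  rewrite scalemxAr -mulmx11l -mulmxA -trmx_mul -E' trmxK -eqx -gE.
  exact: E.
have k0 : (y *m (g' w1)^T) 0 0 != 0.
  by apply: contraTneq (indep_neq0 i) => k0; rewrite key k0 scale0r eqxx.
apply: (indepF i (a := (y *m (g' w2)^T) 0 0 / (y *m (g' w1)^T) 0 0)).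
by rewrite [psi x0 w1]key scalerA divfK // -key.
Qed.

End Uniqueness.

(** * Increments of a bijection that preserves full-rank differences *)

Section FullRankPreservers.

Variables (F : fieldType) (m n : nat).
Hypothesis F3 : forall a b : F, exists c : F, c != a /\ c != b.
Hypotheses (hmn : (n <= m)%N) (hn : (1 < n)%N).
Implicit Types (A B X Y : 'M[F]_(m, n)) (x : 'cV[F]_m) (w : 'rV[F]_n).

(** Being phrased by full-rank differences, [between] passes through the bijection. The inverse is
    an explicit argument so that the lemma serves both directions. *)
Lemma preserver_line (phi psi : 'M[F]_(m, n) -> 'M[F]_(m, n)) :
  cancel phi psi -> cancel psi phi ->
  (forall A B, \rank (A - B) = n <-> \rank (phi A - phi B) = n) ->
  forall A B, \rank (A - B) = 1%N -> \rank (phi A - phi B) = 1%N /\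
    forall t, exists s, phi (A + t *: (B - A)) = phi A + s *: (phi B - phi A).
Proof.
move=> phiK psiK phi_rank A B AB1.
have AB : A != B.
  by apply: contra_eq_neq AB1 => ->; rewrite subrr mxrank0.
have phi_inj := can_inj phiK.
have key t : t != 0 -> t != 1 -> \rank (phi A - phi B) = 1%N /\
    exists s, phi (A + t *: (B - A)) = phi A + s *: (phi B - phi A).
  move=> t0 t1; apply: between_line => //.
  - by rewrite (inj_eq phi_inj).
  - rewrite (inj_eq phi_inj) -subr_eq0 addrAC subrr add0r scaler_eq0 negb_or t0.
    by rewrite subr_eq0 eq_sym.
  - rewrite (inj_eq phi_inj); apply: contra_neq t1 => E.
    apply: (scaler_vecI (v := B - A)); first by rewrite subr_eq0 eq_sym.
    by rewrite scale1r -{2}E [RHS]addrAC subrr add0r.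
  - move=> X; rewrite -[X]psiK => /(proj2 (phi_rank _ _)) R.
    by case: (line_between AB1 t0 t1 R) => /phi_rank; [left|right].
(* Adjacency of the images requires a third point of the line; the parameters 0 and 1 are the
   endpoints themselves. *)
have [c [c0 c1]] := F3 0 1; have [r _] := key c c0 c1; split=> // t.
have [->|t0] := eqVneq t 0; first by exists 0; rewrite !scale0r !addr0.
have [->|t1] := eqVneq t 1; first by exists 1; rewrite !scale1r ![_ + (_ - _)]addrC !subrK.
by have [] := key t t0 t1.
Qed.

Variables phi phi' : 'M[F]_(m, n) -> 'M[F]_(m, n).
Hypotheses (phiK : cancel phi phi') (phi'K : cancel phi' phi).
Hypothesis phi_rank :
  forall A B, \rank (A - B) = n <-> \rank (phi A - phi B) = n.

Let phi'_rank A B : \rank (A - B) = n <-> \rank (phi' A - phi' B) = n.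
Proof. by case: (phi_rank (phi' A) (phi' B)); rewrite !phi'K; split. Qed.

Let phi_line := preserver_line phiK phi'K phi_rank.
Let phi'_line := preserver_line phi'K phiK phi'_rank.

Let phi_inj : injective phi := can_inj phiK.

Definition increment X (x : 'cV[F]_m) (w : 'rV[F]_n) := phi (X + x *m w) - phi X.

(** The linear map [j] stands for [mulmx x] and for [mulmx^~ w]. Its rank-one values make any two
    points of [X + j V] adjacent, so [preserver_line] supplies the hypotheses of the affine
    theorem. *)
Let increment_semilinear (V : lmodType F) (e1 e2 : V) (j : V -> 'M[F]_(m, n)) X :
  indep (V := V) e1 e2 -> {morph j : u v / u + v} -> (forall a v, j (a *: v) = a *: j v) ->
  (forall v, v != 0 -> \rank (j v) = 1%N) ->
  exists2 sigma : {rmorphism F -> F}, forall b, exists a, sigma a = b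
    & semilinear_map sigma (fun v => phi (X + j v) - phi X).
Proof.
move=> e12 jD jZ jr.
have jB u v : j (u - v) = j u - j v by rewrite jD -scaleN1r jZ scaleN1r.
have j0 : j 0 = 0 by rewrite -(subrr (0 : V)) jB subrr.
have jline u v a : X + j (u + a *: (v - u)) = X + j u + a *: (X + j v - (X + j u)).
  by rewrite jD jZ jB opprD addrACA subrr add0r addrA.
have jr' u v : u != v -> \rank (X + j u - (X + j v)) = 1%N.
  by move=> uv; rewrite opprD addrACA subrr add0r -jB jr // subr_eq0.
have sub (A B C : 'M[F]_(m, n)) b : C = A + b *: (B - A) ->
    C - phi X = A - phi X + b *: (B - phi X - (A - phi X)).
  by move=> ->; rewrite opprB addrA subrK addrAC.
apply: (affine_fundamental_theorem F3 _ _ _ _ e12).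
- by rewrite j0 addr0 subrr.
- move=> u v /addIr/phi_inj/addrI E; apply/eqP; rewrite -subr_eq0.
  by apply: contraTT isT => /jr; rewrite jB E subrr mxrank0.
- move=> u v a; have [->|uv] := eqVneq u v.
    by exists 0; rewrite !subrr !scaler0 !addr0.
  have [_ /(_ a)[b E]] := phi_line (jr' _ _ uv); exists b.
  by rewrite jline; apply: sub.
- move=> u v b; have [->|uv] := eqVneq u v.
    by exists 0; rewrite !subrr !scaler0 !addr0.
  have [r _] := phi_line (jr' _ _ uv).
  have [_ /(_ b)[a E]] := phi'_line r; exists a.
  by rewrite !phiK in E; rewrite jline; apply: sub; rewrite -E phi'K.
Qed.

Lemma increment_bisemilinear X :
  exists2 sigma : {rmorphism F -> F}, forall b, exists a, sigma a = b
    & rank1_bisemilinear sigma (increment X).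
Proof.
have m1 : (1 < m)%N := leq_trans hn hmn.
have [x1 [x2 x12]] := indep_cV F m1; have [w1 [w2 w12]] := indep_rV F hn.
have row_map x : x != 0 -> exists2 sigma : {rmorphism F -> F},
    forall b, exists a, sigma a = b & semilinear_map sigma (increment X x).
  move=> x0; apply: (increment_semilinear X w12 (j := mulmx x)).
  - exact: mulmxDr.
  - by move=> a v; rewrite scalemxAr.
  - by move=> v; apply: rank_cV_rV.
have col_map w : w != 0 -> exists2 sigma : {rmorphism F -> F},
    forall b, exists a, sigma a = b & semilinear_map sigma ((increment X)^~ w).
  move=> w0; apply: (increment_semilinear X x12 (j := mulmx^~ w)).
  - by move=> u v; apply: mulmxDl.
  - by move=> a v; rewrite scalemxAl.
  - by move=> v v0; apply: rank_cV_rV.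
have incr1 x w : x != 0 -> w != 0 -> \rank (increment X x w) = 1%N.
  move=> x0 w0; apply: (phi_line _).1; rewrite addrAC subrr add0r.
  exact: rank_cV_rV.
have [sigma sigma_onto s1] := row_map _ (indep_neq0 x12).
exists sigma => //.
(* The automorphisms of a row slice and a column slice coincide because
   [(a *: x) *m w = x *m (a *: w)]; so the one at [x1] serves all columns, and then all rows. *)
have agree x w (s t : F -> F) : x != 0 -> w != 0 ->
    semilinear_map s (increment X x) -> semilinear_map t ((increment X)^~ w) -> s =1 t.
  move=> x0 w0 [_ sZ] [_ tZ] a; apply: (scaler_vecI (v := increment X x w)).
    by rewrite -mxrank_eq0 incr1.
  by rewrite -sZ -tZ /increment -scalemxAl scalemxAr.
have w10 := indep_neq0 w12; have x10 := indep_neq0 x12.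
have incr0 w : increment X 0 w = 0 by rewrite /increment mul0mx addr0 subrr.
have incr0r x : increment X x 0 = 0 by rewrite /increment mulmx0 addr0 subrr.
have s_col w : semilinear_map sigma ((increment X)^~ w).
  have [->|w0] := eqVneq w 0.
    by split=> [u v|a u]; rewrite !incr0r ?addr0 ?scaler0.
  have [tau _ t1] := col_map _ w0; have st := agree _ _ _ _ x10 w0 s1 t1.
  by case: t1 => tD tZ; split=> // a x; rewrite st.
split=> // x; have [->|x0] := eqVneq x 0.
  by split=> [u v|a u]; rewrite !incr0 ?addr0 ?scaler0.
have [tau _ t1] := row_map _ x0; have st := agree _ _ _ _ x0 w10 t1 (s_col w1).
by case: t1 => tD tZ; split=> // a w; rewrite tZ st.
Qed.

(** Otherwise two images would be equal or adjacent, and the inverse map would make their preimages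
    so, whose difference has rank two. *)
Lemma increment_separates X : separates (increment X).
Proof.
move=> x x' w w' xx' ww'; rewrite /increment opprB addrA subrK.
have r2 : \rank ((X + x *m w) - (X + x' *m w')) = 2%N.
  rewrite opprD addrACA subrr add0r -mulNmx rank_indep_sum //.
  by move=> a b; rewrite scalerN -scaleNr => /xx'[-> /eqP]; rewrite oppr_eq0 => /eqP.
rewrite ltnNge; apply/negP; rewrite leq_eqVlt ltnS leqn0 mxrank_eq0 subr_eq0.
case/orP=> [/eqP/phi'_line[]|/eqP/phi_inj E]; first by rewrite !phiK r2.
by move: r2; rewrite E subrr mxrank0.
Qed.

Lemma increment_splits X : exists2 sigma : {rmorphism F -> F},
    forall b, exists a, sigma a = b
    & rank1_bisemilinear sigma (increment X) /\ (splits sigma (increment X) \/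
      splits sigma (fun x w => (increment X x w)^T)).
Proof.
have [sigma sigma_onto incrS] := increment_bisemilinear X; exists sigma => //.
have m1 : (1 < m)%N := leq_trans hn hmn.
have [x1 [x2 x12]] := indep_cV F m1; have [w1 [w2 w12]] := indep_rV F hn.
split=> //; apply: (rank1_bisemilinear_splits sigma_onto x12 w12 incrS).
exact: increment_separates.
Qed.

Lemma increment_step X x0 w0 x w :
  increment (X + x0 *m w0) x w = increment X x w.
Proof.
have [->|x00] := eqVneq x0 0; first by rewrite mul0mx addr0.
have [->|w00] := eqVneq w0 0; first by rewrite mulmx0 addr0.
have [w1 [w2 w12]] := indep_rV F hn.
have [sigma sigma_onto [incrS sp]] := increment_splits X.
have [tau tau_onto [incrS' sp']] := increment_splits (X + x0 *m w0).
(* By additivity, moving from [X + x0 *m w0] to [X + x0 *m (w0 + v)] adds [increment X x0 v]. *)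
have eqx : increment X x0 =1 increment (X + x0 *m w0) x0.
  move=> v; have [/(_ x0)[D _] _ _] := incrS.
  apply: (addrI (increment X x0 w0)); rewrite -D /increment mulmxDr addrA.
  by rewrite [RHS]addrC addrA subrK.
have eqw : (increment X)^~ w0 =1 (increment (X + x0 *m w0))^~ w0.
  move=> v; have [_ /(_ w0)[D _] _] := incrS.
  apply: (addrI (increment X x0 w0)); rewrite -D /increment mulmxDl addrA.
  by rewrite [RHS]addrC addrA subrK.
have nz : increment X x0 w0 != 0.
  by have [_ _ r] := incrS; rewrite -mxrank_eq0 r.
have ind (s : {rmorphism F -> F}) Y : (forall b, exists a, s a = b) -> rank1_bisemilinear s (increment Y) ->
    indep (increment Y x0 w1) (increment Y x0 w2).
  move=> s_onto [sl _ r]; apply: (semilinear_indep s_onto (sl x0)) => // v v0.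
  by rewrite -mxrank_eq0 r.
(* Mixed types are excluded by [splits_tr_neq]; equal types give equality by [splits_eq], after
   transposition in the last case. *)
symmetry; case: sp sp' => sp [] sp'.
- exact: (splits_eq sp sp' nz eqx eqw).
- by case: (splits_tr_neq sp sp' eqx (ind _ _ sigma_onto incrS)).
- by case: (splits_tr_neq sp' sp (fsym eqx) (ind _ _ tau_onto incrS')).
- apply: trmx_inj; apply: (splits_eq sp sp' (x0 := x0) (w0 := w0)) => [|v|v].
  + by rewrite trmx_eq0.
  + by rewrite eqx.
  + by rewrite [increment X v w0]eqw.
Qed.

Lemma increment_const X x w : increment X x w = increment 0 x w.
Proof.
elim/mx_rank1_ind: X x w => // X x w IH y v.
by rewrite increment_step.
Qed.

Lemma preserver_formula (L : 'M[F]_(m, n) -> 'M[F]_(m, n)) :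
  {morph L : A B / A + B} -> (forall x w, increment 0 x w = L (x *m w)) ->
  forall A, phi A = L A + phi 0.
Proof.
move=> LD LE; elim/mx_rank1_ind => [|A x w IH].
  by rewrite -{1}[phi 0]add0r; congr (_ + _); apply: (addrI (L 0)); rewrite -LD !addr0.
rewrite LD -LE -(increment_const A) /increment IH.
by rewrite addrCA opprD [L A + _]addrA subrr add0r subrK.
Qed.

End FullRankPreservers.

(** * From the increment at 0 to the two standard forms *)

Theorem theorem1p1 (F : fieldType)
    (hF : exists x y z : F, [/\ x != y, y != z & x != z])
    (m n : nat) (hmn : (n <= m)%N) (hn : (2 <= n)%N)
    (phi : 'M[F]_(m, n) -> 'M[F]_(m, n))
    (phi_bij : bijective phi)
    (phi_rank : forall A B : 'M[F]_(m, n),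
        \rank (A - B)%R = n <-> \rank (phi A - phi B)%R = n) :
  (exists (T : 'M[F]_m) (S : 'M[F]_n) (R : 'M[F]_(m, n))
          (sigma : {rmorphism F -> F}),
      [/\ T \in unitmx, S \in unitmx, bijective sigma
        & forall A : 'M[F]_(m, n), phi A = T *m map_mx sigma A *m S + R])
  \/
  (exists (emn : m = n) (T : 'M[F]_m) (S : 'M[F]_n) (R : 'M[F]_(m, n))
          (sigma : {rmorphism F -> F}),
      [/\ T \in unitmx, S \in unitmx, bijective sigma
        & forall A : 'M[F]_(m, n),
            phi A = T *m castmx (esym emn, emn) (map_mx sigma A)^T *m S + R]).
Proof.
have F3 (a b : F) : exists c : F, c != a /\ c != b.
  have [x [y [z [xy yz xz]]]] := hF.
  case: (eqVneq x a) (eqVneq x b) => [xa|xa] [xb|xb].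
  - by exists y; rewrite -xa -xb eq_sym.
  - have [yb|yb] := eqVneq y b; [exists z|exists y].
      by rewrite -xa -yb ![z == _]eq_sym.
    by rewrite -xa eq_sym.
  - have [ya|ya] := eqVneq y a; [exists z|exists y].
      by rewrite -xb -ya ![z == _]eq_sym.
    by rewrite -xb [y == x]eq_sym.
  - by exists x.
have [phi' phiK phi'K] := phi_bij.
have [sigma sigma_onto [[_ _ r] sp]] :=
  increment_splits F3 hmn hn phiK phi'K phi_rank 0.
have sigma_bij := onto_bijective sigma_onto.
have incr_neq0 x w : x != 0 -> w != 0 -> increment phi 0 x w != 0.
  by move=> x0 w0; rewrite -mxrank_eq0 r.
have m1 := leq_trans hn hmn.
case: sp => sp.
  have [T [S [Tfree Sfree E]]] := splits_matrices sigma_onto m1 hn incr_neq0 sp.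
  left; exists T, S, (phi 0), sigma; split=> //.
  - by rewrite -unitmx_tr -row_free_unit.
  - by rewrite -row_free_unit.
  apply: (preserver_formula F3 hmn hn phiK phi'K phi_rank
    (L := fun A => T *m map_mx sigma A *m S)) => // A B.
  by rewrite map_mxD mulmxDr mulmxDl.
have [|T [S [Tfree Sfree E]]] := splits_matrices sigma_onto m1 hn _ sp.
  by move=> x w x0 w0; rewrite trmx_eq0 incr_neq0.
have formula : forall A, phi A = (T *m map_mx sigma A *m S)^T + phi 0.
  apply: (preserver_formula F3 hmn hn phiK phi'K phi_rank
    (L := fun A => (T *m map_mx sigma A *m S)^T)) => [A B|x w].
    by rewrite map_mxD mulmxDr mulmxDl raddfD.
  by rewrite -E trmxK.
(* Here [T] is an n by m matrix with independent columns, which gives [m <= n]. *)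
have emn : m = n.
  by apply/eqP; rewrite eqn_leq hmn andbT -(eqP Tfree) rank_leq_col.
right; subst m; exists (erefl n), S^T, T^T, (phi 0), sigma; split=> //.
- by rewrite unitmx_tr -row_free_unit.
- by rewrite -row_free_unit.
by move=> A; rewrite castmx_id formula !trmx_mul !mulmxA.
Qed.
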